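(* Let $m\ge2$ and $k\ge1$ be integers, put $n=2^{m-1}-1$, and let $X=\mathbf{P}^1\times\cdots\times\mathbf{P}^1$ ($m$ factors), with homogeneous coordinates $[\alpha_{i0}:\alpha_{i1}]$ on the $i$-th factor. For $\epsilon=(\epsilon_1,\dots,\epsilon_m)\in\{0,1\}^m$ let $a_{\epsilon_1\epsilon_2\cdots\epsilon_m}=\alpha_{1\epsilon_1}\alpha_{2\epsilon_2}\cdots\alpha_{m\epsilon_m}$, a monomial of multidegree $(1,\dots,1)$. For $0\le j\le n$ let $\epsilon_2\cdots\epsilon_m$ be the binary expansion of $j$ with $m-1$ digits (most significant digit first), and put $x_j=a_{0\epsilon_2\cdots\epsilon_m}$ and $y_j=a_{1\epsilon_2\cdots\epsilon_m}$. Put $x_j=y_j=0$ for $j<0$ or $j>n$. Let $\overline{B}=(\,B_x\mid B_y\,)$ be the $k\times(2n+2k)$ matrix whose $k\times(n+k)$ blocks are $$(B_x)_{i,l}=x_{l-i},\qquad (B_y)_{i,l}=y_{l-i}\qquad(1\le i\le k,\ 1\le l\le n+k),$$ and let $\overline{A}$ be the $(2n+2k)\times k$ matrix with upper block $-A_y$ and lower block $A_x$, where the $(n+k)\times k$ matrices $A_x,A_y$ are $$(A_x)_{l,j}=x_{n-l+j},\qquad (A_y)_{l,j}=y_{n-l+j}\qquad(1\le l\le n+k,\ 1\le j\le k).$$ Then $\overline{B}\cdot\overline{A}=0$, the matrices $\overline{A}$ and $\overline{B}$ have maximal rank, and they define a monad on $X$: $$0\longrightarrow\mathcal{O}_X(-1,\dots,-1)^{\oplus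 k}\xrightarrow{\ \overline{A}\ }\mathcal{O}_X^{\oplus(2n+2k)}\xrightarrow{\ \overline{B}\ }\mathcal{O}_X(1,\dots,1)^{\oplus k}\longrightarrow0 .$$
   Context: Varieties are over $\mathbb{C}$. $\mathcal{O}_X(d_1,\dots,d_m)=p_1^*\mathcal{O}_{\mathbf{P}^1}(d_1)\otimes\cdots\otimes p_m^*\mathcal{O}_{\mathbf{P}^1}(d_m)$, where $p_i$ is the projection to the $i$-th factor; its sections for $d_i\ge 0$ are the polynomials of multidegree $(d_1,\dots,d_m)$ in the $\alpha_{i0},\alpha_{i1}$, and matrices of such sections are viewed as maps of sums of line bundles. A monad on a nonsingular projective variety $X$ is a complex of vector bundles $0\to M_0\xrightarrow{a}M_1\xrightarrow{b}M_2\to0$ (so $b\circ a=0$) that is exact at $M_0$ and at $M_2$, i.e. $a$ is injective and $b$ is surjective. The matrices $\overline{A}$ and $\overline{B}$ having maximal rank means that the corresponding maps are injective and surjective, respectively. *)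

(* Defs.v *)
From HB Require Import structures.
From mathcomp Require Import all_boot all_order all_algebra.
From mathcomp Require Import complex mpoly reals.

Set Implicit Arguments.
Unset Strict Implicit.
Unset Printing Implicit Defensive.

Import Order.TTheory GRing.Theory Num.Theory.
Local Open Scope ring_scope.

(* Varieties are classical varieties over an algebraically closed field K
   (their closed points, with the Zariski topology). *)

(* P^1 is the set of lines through the origin of K^2. *)
Definition P1 (K : closedFieldType) : Type :=
  {L : {vspace 'rV[K]_2} | \dim L == 1%N}.

Definition multiP1 (K : closedFieldType) (m : nat) : Type := 'I_m -> P1 K.

(* Row i of alpha is a pair of homogeneous coordinates
   [alpha i 0 : alpha i 1] of the i-th component of x. *)
Definition hcoords (K : closedFieldType) (m : nat)
    (x : multiP1 K m) (alpha : 'M[K]_(m, 2)) : Prop :=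
  forall i : 'I_m, row i alpha \in val (x i) /\ row i alpha != 0.

(* The ring K[alpha_{i,e} : i < m, e < 2]; the variable alpha_{i,e} has index
   mxvec_index i e, so that it evaluates to alpha i e under [peval]. *)
Notation cox_ring K m := {mpoly K[(m * 2)%N]}.

Definition hvar (K : closedFieldType) (m : nat) (i : 'I_m) (e : 'I_2) :
    cox_ring K m := 'X_(mxvec_index i e).

Definition peval (K : closedFieldType) (m : nat)
    (alpha : 'M[K]_(m, 2)) (P : cox_ring K m) : K :=
  P.@[fun v => mxvec alpha 0 v].

Definition mxeval (K : closedFieldType) (m p q : nat)
    (alpha : 'M[K]_(m, 2)) (M : 'M[cox_ring K m]_(p, q)) : 'M[K]_(p, q) :=
  map_mx (peval alpha) M.

(* P is multihomogeneous of multidegree d; as usual 0 has every multidegree,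
   and it is the only polynomial whose multidegree has a negative entry. *)
Definition multihom (K : closedFieldType) (m : nat) (d : 'I_m -> int)
    (P : cox_ring K m) : Prop :=
  forall mon, mon \in msupp P -> forall i : 'I_m,
    (mon (mxvec_index i 0%R) + mon (mxvec_index i 1%R))%N%:Z = d i.

Definition zariski_closed (K : closedFieldType) (m : nat)
    (Z : multiP1 K m -> Prop) : Prop :=
  exists F : cox_ring K m -> Prop,
    (forall P, F P -> exists d, multihom d P) /\
    (forall x, Z x <->
       forall P, F P -> forall alpha, hcoords x alpha -> peval alpha P = 0).

Definition zariski_open (K : closedFieldType) (m : nat)
    (U : multiP1 K m -> Prop) : Prop :=
  zariski_closed (fun x => ~ U x).

(* Sections over U of O_X(d) = O_X(d_1, ..., d_m): functions of the
   homogeneous coordinates of the points of U that are locally fractions P / Q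
   of multihomogeneous polynomials with deg P - deg Q = d and Q without zeros.
   The values of s off the homogeneous coordinates of points of U are
   irrelevant, so sections over U have to be compared by [eq_over U]. *)
Definition line_section (K : closedFieldType) (m : nat) (d : 'I_m -> int)
    (U : multiP1 K m -> Prop) (s : 'M[K]_(m, 2) -> K) : Prop :=
  forall x, U x ->
  exists V : multiP1 K m -> Prop,
    zariski_open V /\ V x /\ (forall y, V y -> U y) /\
    exists (dP dQ : 'I_m -> int) (P Q : cox_ring K m),
      multihom dP P /\ multihom dQ Q /\ (forall i, dP i - dQ i = d i) /\
      forall y alpha, V y -> hcoords y alpha ->
        peval alpha Q != 0 /\ s alpha = peval alpha P / peval alpha Q.

(* A direct sum of r line bundles is given by the list D of their
   multidegrees; [bundle_section D U] are the sections over U of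
   O_X(D 0) (+) ... (+) O_X(D (r-1)). *)
Definition bundle_section (K : closedFieldType) (m r : nat)
    (D : 'I_r -> 'I_m -> int) (U : multiP1 K m -> Prop)
    (s : 'M[K]_(m, 2) -> 'cV[K]_r) : Prop :=
  forall j : 'I_r, line_section (D j) U (fun alpha => s alpha j 0).

Definition eq_over (K : closedFieldType) (m r : nat)
    (U : multiP1 K m -> Prop) (s t : 'M[K]_(m, 2) -> 'cV[K]_r) : Prop :=
  forall x alpha, U x -> hcoords x alpha -> s alpha = t alpha.

(* O_X(d)^{(+) r} *)
Definition Osum (m r : nat) (d : int) : 'I_r -> 'I_m -> int :=
  fun _ _ => d.
Arguments Osum : clear implicits.

(* M represents a map (+)_j O_X(D j) -> (+)_i O_X(E i): its (i, j) entry is a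
   global section of O_X(E i - D j). *)
Definition bundle_map (K : closedFieldType) (m p q : nat)
    (D : 'I_q -> 'I_m -> int) (E : 'I_p -> 'I_m -> int)
    (M : 'M[cox_ring K m]_(p, q)) : Prop :=
  forall i j, multihom (fun h => E i h - D j h) (M i j).

Definition on_sections (K : closedFieldType) (m p q : nat)
    (M : 'M[cox_ring K m]_(p, q)) (s : 'M[K]_(m, 2) -> 'cV[K]_q) :
    'M[K]_(m, 2) -> 'cV[K]_p :=
  fun alpha => mxeval alpha M *m s alpha.

Definition sheaf_injective (K : closedFieldType) (m p q : nat)
    (D : 'I_q -> 'I_m -> int) (M : 'M[cox_ring K m]_(p, q)) : Prop :=
  forall U s, zariski_open U -> bundle_section D U s ->
    eq_over U (on_sections M s) (fun _ => 0) -> eq_over U s (fun _ => 0).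

(* Surjectivity as a map of sheaves: sections lift locally. *)
Definition sheaf_surjective (K : closedFieldType) (m p q : nat)
    (D : 'I_q -> 'I_m -> int) (E : 'I_p -> 'I_m -> int)
    (M : 'M[cox_ring K m]_(p, q)) : Prop :=
  forall U t, zariski_open U -> bundle_section E U t ->
  forall x, U x ->
  exists V : multiP1 K m -> Prop,
    zariski_open V /\ V x /\ (forall y, V y -> U y) /\
    exists s, bundle_section D V s /\ eq_over V (on_sections M s) t.

(* 0 -> M0 --A--> M1 --B--> M2 -> 0 is a monad, where each Mi is the sum of
   the line bundles with multidegrees Di. *)
Definition is_monad (K : closedFieldType) (m r0 r1 r2 : nat)
    (D0 : 'I_r0 -> 'I_m -> int) (D1 : 'I_r1 -> 'I_m -> int)
    (D2 : 'I_r2 -> 'I_m -> int)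
    (A : 'M[cox_ring K m]_(r1, r0)) (B : 'M[cox_ring K m]_(r2, r1)) : Prop :=
  [/\ bundle_map D0 D1 A,
      bundle_map D1 D2 B,
      forall U s, zariski_open U -> bundle_section D0 U s ->
        eq_over U (on_sections B (on_sections A s)) (fun _ => 0),
      sheaf_injective D0 A
    & sheaf_surjective D1 D2 B].

(* Injectivity and surjectivity on the fibres at all points of X: homogeneous
   coordinates alpha of x trivialize the fibres of all O_X(d) at x, and the
   fibre of the map M is then the matrix M(alpha). *)
Definition fibre_injective (K : closedFieldType) (m p q : nat)
    (M : 'M[cox_ring K m]_(p, q)) : Prop :=
  forall (x : multiP1 K m) alpha, hcoords x alpha ->
    injective (fun v : 'cV[K]_q => mxeval alpha M *m v).

Definition fibre_surjective (K : closedFieldType) (m p q : nat)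
    (M : 'M[cox_ring K m]_(p, q)) : Prop :=
  forall (x : multiP1 K m) alpha, hcoords x alpha ->
    forall w : 'cV[K]_p, exists v : 'cV[K]_q, mxeval alpha M *m v = w.

Definition nn (m : nat) : nat := (2 ^ (m - 1) - 1)%N.

Definition a_mon (K : closedFieldType) (m : nat) (eps : 'I_m -> 'I_2) :
    cox_ring K m := \prod_(i < m) hvar K i (eps i).

(* The multi-index (e, eps_2, ..., eps_m) with eps_2...eps_m the binary
   expansion of j, most significant digit first. Factors are numbered from 0
   here: factor i > 0 carries the digit of weight 2 ^ (m - 1 - i). *)
Definition eps_of (m : nat) (e : 'I_2) (j : nat) : 'I_m -> 'I_2 :=
  fun i => if (i == 0 :> nat)%N then e
           else inord ((j %/ 2 ^ (m - 1 - i)) %% 2)%N.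

(* [xy K m 0 j] is x_j and [xy K m 1 j] is y_j, for every integer j. *)
Definition xy (K : closedFieldType) (m : nat) (e : 'I_2) (j : int) :
    cox_ring K m :=
  if j is Posz j' then
    if (j' <= nn m)%N then a_mon K (eps_of e j') else 0
  else 0.

(* Rows and columns are numbered from 0, which leaves l - i and l - j
   unchanged. *)
Definition B_blk (K : closedFieldType) (m k : nat) (e : 'I_2) :
    'M[cox_ring K m]_(k, nn m + k) :=
  \matrix_(i, l) xy K m e ((l : nat)%:Z - (i : nat)%:Z).

Definition A_blk (K : closedFieldType) (m k : nat) (e : 'I_2) :
    'M[cox_ring K m]_(nn m + k, k) :=
  \matrix_(l, j) xy K m e ((nn m)%:Z - (l : nat)%:Z + (j : nat)%:Z).

(* The middle dimension 2n + 2k is written (n + k) + (n + k). *)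
Definition Bbar (K : closedFieldType) (m k : nat) :
    'M[cox_ring K m]_(k, (nn m + k) + (nn m + k)) :=
  row_mx (B_blk K m k 0) (B_blk K m k 1).

Definition Abar (K : closedFieldType) (m k : nat) :
    'M[cox_ring K m]_((nn m + k) + (nn m + k), k) :=
  col_mx (- A_blk K m k 1) (A_blk K m k 0).

(* Main.v *)
Require Import Defs.
From HB Require Import structures.
From mathcomp Require Import all_boot all_order all_algebra.
From mathcomp Require Import complex mpoly reals boolp zify.

(* Every x_j (resp. y_j) is alpha_{1,0} z_j (resp. alpha_{1,1} z_j) for one and
   the same monomial z_j in the coordinates of the last m - 1 factors. Hence
   B = (alpha_{1,0} T | alpha_{1,1} T), where T is the Toeplitz matrix of the
   sequence z, and A = (- alpha_{1,1} S ; alpha_{1,0} S), where S is the Toeplitz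
   matrix of the reversed sequence; this gives B A = 0. At a point of X some
   alpha_{1,e} and some z_j are nonzero, and T and S have full rank because
   convolution with a nonzero finite sequence is injective. *)

Set Implicit Arguments.
Unset Strict Implicit.
Unset Printing Implicit Defensive.

Import Order.TTheory GRing.Theory Num.Theory.
Local Open Scope ring_scope.

(** * Multihomogeneous polynomials *)

Section Multihomogeneous.
Variables (K : closedFieldType) (m : nat).
Implicit Types (P Q : cox_ring K m) (d : 'I_m -> int) (alpha beta : 'M[K]_(m, 2)).

Lemma mxvec_index_eq (i j : 'I_m) (e f : 'I_2) :
  (mxvec_index i e == mxvec_index j f) = (i == j) && (e == f).
Proof.
by rewrite /mxvec_index (inj_eq (@cast_ord_inj _ _ _)) (inj_eq enum_rank_inj).
Qed.

Lemma multihom_ext d d' P : multihom d P -> d =1 d' -> multihom d' P.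
Proof. by move=> hP dd' mon /hP hmon i; rewrite hmon dd'. Qed.

Lemma multihom0 d : multihom d (0 : cox_ring K m).
Proof. by move=> mon; rewrite msupp0. Qed.

Lemma multihomD d P Q : multihom d P -> multihom d Q -> multihom d (P + Q).
Proof. by move=> hP hQ mon /msuppD_le; rewrite mem_cat => /orP[/hP|/hQ]. Qed.

Lemma multihomZ d (c : K) P : multihom d P -> multihom d (c *: P).
Proof. by move=> hP mon /msuppZ_le /hP. Qed.

Lemma multihomN d P : multihom d P -> multihom d (- P).
Proof. by rewrite -scaleN1r; apply: multihomZ. Qed.

Lemma multihom_sum d (I : Type) (r : seq I) (p : pred I) (F : I -> cox_ring K m) :
  (forall i, p i -> multihom d (F i)) -> multihom d (\sum_(i <- r | p i) F i).
Proof.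
move=> hF; apply: (big_ind (multihom d)) => //; first exact: multihom0.
exact: multihomD.
Qed.

Lemma multihomC (c : K) : multihom (fun=> 0) (c%:MP : cox_ring K m).
Proof.
by move=> mon; rewrite msuppC; case: eqP => // _; rewrite inE => /eqP -> i; rewrite !mnm0E.
Qed.

Lemma multihomM d d' P Q :
  multihom d P -> multihom d' Q -> multihom (fun i => d i + d' i) (P * Q).
Proof.
move=> hP hQ mon /msuppM_le /allpairsP[[m1 m2] /= [/hP h1 /hQ h2 ->]] i.
by rewrite -h1 -h2 !mnmDE addnACA PoszD.
Qed.

Lemma multihom_prod (n : nat) (d : 'I_n -> 'I_m -> int) (F : 'I_n -> cox_ring K m) :
  (forall j, multihom (d j) (F j)) ->
  multihom (fun i => \sum_(j < n) d j i) (\prod_(j < n) F j).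
Proof.
elim: n d F => [|n IH] d F hF.
  rewrite big_ord0 -mpolyC1; refine (multihom_ext (@multihomC 1) _) => i.
  by rewrite big_ord0.
rewrite big_ord_recl; have hF' := IH _ _ (fun j => hF (lift ord0 j)).
by refine (multihom_ext (multihomM (hF ord0) hF') _) => i; rewrite big_ord_recl.
Qed.

(** Each Leibniz term is a sign times a product of [n] entries; the sign becomes a constant
    polynomial, so that [multihomZ] applies. *)
Lemma multihom_det (n : nat) (N : 'M[cox_ring K m]_n) :
  (forall i j, multihom (fun=> 1) (N i j)) -> multihom (fun=> n%:Z) (\det N).
Proof.
move=> hN; apply: multihom_sum => s _; rewrite -mpolyC1 -mpolyCN -rmorphXn mul_mpolyC.
apply: multihomZ.
refine (multihom_ext (multihom_prod (fun i => hN i (perm.fun_of_perm s i))) _) => i.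
by rewrite sumr_const card_ord -natz.
Qed.

Lemma multihom_adj (n : nat) (N : 'M[cox_ring K m]_n) :
  (forall i j, multihom (fun=> 1) (N i j)) ->
  forall i j, multihom (fun=> n.-1%:Z) (\adj N i j).
Proof.
move=> hN i j; rewrite mxE /cofactor -mpolyC1 -mpolyCN -rmorphXn mul_mpolyC.
by apply: multihomZ; apply: multihom_det => i' j'; rewrite !mxE.
Qed.

Lemma multihom_hvar (i : 'I_m) (e : 'I_2) :
  multihom (fun j => (i == j)%:Z) (hvar K i e).
Proof.
move=> mon; rewrite /hvar msuppX inE => /eqP -> j.
rewrite !mnm1E !mxvec_index_eq; case: eqP => // _.
by case: e => -[|[|]].
Qed.

Lemma multihom_a_mon (eps : 'I_m -> 'I_2) : multihom (fun=> 1) (a_mon K eps).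
Proof.
refine (multihom_ext (multihom_prod (fun i => @multihom_hvar i (eps i))) _) => i.
rewrite (bigD1 i) //= eqxx big1 ?addr0 // => j /negbTE; first by move=> ->.
Qed.

Lemma multihom_xy (e : 'I_2) (j : int) : multihom (fun=> 1) (xy K m e j).
Proof.
rewrite /xy; case: j => [j|j]; last exact: multihom0.
by case: ifP => _; [exact: multihom_a_mon | exact: multihom0].
Qed.

(** * Change of homogeneous coordinates *)

Lemma prod_mxvec_index (g : 'I_(m * 2) -> K) :
  \prod_v g v = \prod_i \prod_e g (mxvec_index i e).
Proof.
by rewrite pair_bigA (reindex _ (curry_mxvec_bij m 2)); apply: eq_big => [[]|[]].
Qed.

(** A monomial of [P] has degree [d i] in row [i], so it picks up that power of [c i]. A negative
    [d i] forces [P = 0], hence the absolute value in the exponent is harmless. *)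
Lemma peval_scale d P alpha beta (c : 'I_m -> K) :
  multihom d P -> (forall i e, beta i e = c i * alpha i e) ->
  peval beta P = (\prod_i c i ^+ `|d i|) * peval alpha P.
Proof.
move=> hP hc; rewrite /peval !mevalE mulr_sumr; apply: eq_big_seq => mon /hP hmon.
rewrite mulrCA; congr (_ * _).
rewrite !prod_mxvec_index -big_split /=; apply: eq_bigr => i _; rewrite -hmon absz_nat.
rewrite !big_ord_recl !big_ord0 !mxvecE !hc !exprMn !mulr1 exprD.
rewrite (_ : lift ord0 ord0 = 1); last exact/val_inj.
by rewrite mulrACA.
Qed.

Lemma hcoords_ex (x : multiP1 K m) : exists alpha, hcoords x alpha.
Proof.
exists (\matrix_i vpick (val (x i))) => i; rewrite rowK memv_pick; split=> //.
by rewrite vpick0 -dimv_eq0; case: (x i) => L /= /eqP ->.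
Qed.

(** Corresponding rows are nonzero vectors of the same one-dimensional space, hence proportional
    with a nonzero factor. *)
Lemma hcoords_scale (x : multiP1 K m) alpha beta :
  hcoords x alpha -> hcoords x beta ->
  exists2 c : 'I_m -> K, (forall i, c i != 0) &
    forall i e, beta i e = c i * alpha i e.
Proof.
move=> ha hb.
have /fin_all_exists2[c c0 hc] : forall i, exists2 c : K, c != 0 & row i beta = c *: row i alpha.
  move=> i; have [[ain a0] [bin b0]] := (ha i, hb i).
  have /eqP line : <[row i alpha]>%VS == val (x i).
    by rewrite eqEdim -memvE ain dim_vline a0; case: (x i) => L /= /eqP ->.
  have /vlineP[c hc] : row i beta \in <[row i alpha]>%VS by rewrite line.
  by exists c => //; apply: contraNneq b0 => c0; rewrite hc c0 scale0r.
exists c => // i e; have /rowP/(_ e) := hc i.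
by rewrite !mxE.
Qed.

Lemma peval_neq0 d P (x : multiP1 K m) alpha beta :
  multihom d P -> hcoords x alpha -> hcoords x beta ->
  peval alpha P != 0 -> peval beta P != 0.
Proof.
move=> hP ha hb nz; have [c c0 hc] := hcoords_scale ha hb.
rewrite (peval_scale hP hc) mulf_neq0 //; apply/prodf_neq0 => i _.
by rewrite expf_neq0.
Qed.

End Multihomogeneous.

(** * Zariski open sets and sections of line bundles *)

Section Sections.
Variables (K : closedFieldType) (m : nat).
Implicit Types (P Q : cox_ring K m) (d : 'I_m -> int) (alpha beta : 'M[K]_(m, 2)).
Implicit Types (U V : multiP1 K m -> Prop) (s t : 'M[K]_(m, 2) -> K).

(** The principal open set of [Q]. For multihomogeneous [Q] a single choice of coordinates decides
    membership, see [nonvanishing_at]. *)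
Definition nonvanishing Q : multiP1 K m -> Prop :=
  fun x => forall alpha, hcoords x alpha -> peval alpha Q != 0.

Lemma nonvanishing_at d Q (x : multiP1 K m) alpha :
  multihom d Q -> hcoords x alpha -> peval alpha Q != 0 -> nonvanishing Q x.
Proof. by move=> hQ ha nz beta hb; exact: (peval_neq0 hQ ha hb nz). Qed.

Lemma not_nonvanishing d Q (x : multiP1 K m) alpha :
  multihom d Q -> ~ nonvanishing Q x -> hcoords x alpha -> peval alpha Q = 0.
Proof.
by move=> hQ nQ ha; apply/eqP; apply: contra_notT nQ => nz; exact: (nonvanishing_at hQ ha nz).
Qed.

Lemma zariski_open_nonvanishing d Q : multihom d Q -> zariski_open (nonvanishing Q).
Proof.
move=> hQ; exists (fun P => P = Q); split=> [P -> |x]; first by exists d.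
split=> [nQ P -> alpha|vQ nQ]; first exact: (not_nonvanishing hQ nQ).
by have [alpha ha] := hcoords_ex x; have := nQ _ ha; rewrite (vQ _ erefl _ ha) eqxx.
Qed.

(** Open sets are the unions of principal open sets. Openness is defined through the complement, so
    the translation uses classical logic and the existence of coordinates. *)
Lemma zariski_openP U :
  zariski_open U <-> exists F : cox_ring K m -> Prop,
    (forall P, F P -> exists d, multihom d P) /\
    (forall x, U x <-> exists2 P, F P & nonvanishing P x).
Proof.
split=> -[F [hF FU]]; exists F; split=> // x.
  split=> [Ux|[P FP nP] ].
    apply: contrapT => nF; apply: ((FU x).2 _ Ux) => P FP alpha ha.
    have [d hP] := hF _ FP; apply: (not_nonvanishing hP _ ha) => nP.
    by apply: nF; exists P.
  apply: contrapT => /FU /(_ _ FP); have [alpha ha] := hcoords_ex x.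
  by move=> /(_ _ ha) v; have := nP _ ha; rewrite v eqxx.
split=> [nU P FP alpha ha|vF /FU[P FP nP] ].
  have [d hP] := hF _ FP; apply: (not_nonvanishing hP _ ha) => nP.
  by apply: nU; apply/FU; exists P.
have [alpha ha] := hcoords_ex x.
by have := nP _ ha; rewrite (vF _ FP _ ha) eqxx.
Qed.

(** The principal open sets of [P] and [Q] meet in that of [P * Q]. *)
Lemma zariski_openI U V :
  zariski_open U -> zariski_open V -> zariski_open (fun x => U x /\ V x).
Proof.
move=> /zariski_openP[F [hF FU]] /zariski_openP[G [hG GV]].
apply/zariski_openP.
exists (fun R => exists P Q, [/\ F P, G Q & R = P * Q]); split.
  move=> _ [P [Q [/hF[d hP] /hG[d' hQ] ->]]].
  by exists (fun i => d i + d' i); apply: multihomM.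
move=> x; split=> [[/FU[P FP nP] /GV[Q GQ nQ]]|[_ [P [Q [FP GQ ->]] nPQ]]].
  exists (P * Q) => [|alpha ha]; first by exists P, Q.
  by rewrite /peval rmorphM mulf_neq0 //; [apply: nP | apply: nQ].
split; [apply/FU; exists P | apply/GV; exists Q] => // alpha /nPQ;
  by rewrite /peval rmorphM mulf_eq0 negb_or => /andP[].
Qed.

(** * Operations on sections of line bundles *)

Lemma line_section_ext d d' U s :
  line_section d U s -> d =1 d' -> line_section d' U s.
Proof.
move=> hs dd' x /hs[V [oV [Vx [VU [dP [dQ [P [Q [hP [hQ [hd e]]]]]]]]]]].
by exists V; do 3!split=> //; exists dP, dQ, P, Q; do 3!split=> //; move=> i; rewrite hd.
Qed.

Lemma line_section_sub d U V s :
  zariski_open V -> (forall x, V x -> U x) ->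
  line_section d U s -> line_section d V s.
Proof.
move=> oV VU hs x Vx; have [W [oW [Wx [_ [dP [dQ [P [Q [hP [hQ [hd e]]]]]]]]]]] := hs _ (VU _ Vx).
(* The neighbourhood [W] lies in [U] but perhaps not in [V], so it is cut down. *)
exists (fun x => W x /\ V x); split; first exact: zariski_openI.
do 2!split=> //; first by move=> y [].
by exists dP, dQ, P, Q; do 3!split=> //; move=> y alpha [Wy _]; apply: e.
Qed.

Lemma line_section_fraction dP dQ P Q U :
  zariski_open U -> multihom dP P -> multihom dQ Q ->
  (forall x, U x -> nonvanishing Q x) ->
  line_section (fun i => dP i - dQ i) U (fun alpha => peval alpha P / peval alpha Q).
Proof.
move=> oU hP hQ nQ x Ux; exists U; do 3!split=> //; exists dP, dQ, P, Q.
by do 3!split=> //; move=> y alpha Uy ha; rewrite (nQ y Uy).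
Qed.

Lemma line_sectionM d d' U s t :
  line_section d U s -> line_section d' U t ->
  line_section (fun i => d i + d' i) U (fun alpha => s alpha * t alpha).
Proof.
move=> hs ht x Ux.
have [V [oV [Vx [VU [dP [dQ [P [Q [hP [hQ [hd e]]]]]]]]]]] := hs x Ux.
have [V' [oV' [V'x [V'U [dP' [dQ' [P' [Q' [hP' [hQ' [hd' e']]]]]]]]]]] := ht x Ux.
exists (fun x => V x /\ V' x); split; first exact: zariski_openI.
do 2!split=> //; first by move=> y [/VU].
exists (fun i => dP i + dP' i), (fun i => dQ i + dQ' i), (P * P'), (Q * Q').
split; first exact: multihomM.
split; first exact: multihomM.
split=> [i|y alpha [Vy V'y] ha]; first by rewrite -hd -hd' opprD addrACA.
have [nQ ->] := e _ _ Vy ha; have [nQ' ->] := e' _ _ V'y ha.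
by rewrite /peval !rmorphM mulf_neq0 // mulf_div.
Qed.

Lemma line_sectionD d U s t :
  line_section d U s -> line_section d U t ->
  line_section d U (fun alpha => s alpha + t alpha).
Proof.
move=> hs ht x Ux.
have [V [oV [Vx [VU [dP [dQ [P [Q [hP [hQ [hd e]]]]]]]]]]] := hs x Ux.
have [V' [oV' [V'x [V'U [dP' [dQ' [P' [Q' [hP' [hQ' [hd' e']]]]]]]]]]] := ht x Ux.
exists (fun x => V x /\ V' x); split; first exact: zariski_openI.
do 2!split=> //; first by move=> y [/VU].
exists (fun i => dP i + dQ' i), (fun i => dQ i + dQ' i), (P * Q' + P' * Q), (Q * Q').
(* Both fractions have multidegree [d], so the two cross products in the numerator share one
   multidegree. *)
have dE i : dP' i + dQ i = dP i + dQ' i.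
  by move: (hd i); rewrite -(hd' i); lia.
split; first by apply: multihomD; [|refine (multihom_ext _ dE)]; exact: multihomM.
split; first exact: multihomM.
split=> [i|y alpha [Vy V'y] ha]; first by rewrite -hd opprD addrACA subrr addr0.
have [nQ ->] := e _ _ Vy ha; have [nQ' ->] := e' _ _ V'y ha.
by rewrite /peval rmorphD !rmorphM mulf_neq0 // addf_div.
Qed.

Lemma line_section0 d U : zariski_open U -> line_section d U (fun=> 0).
Proof.
move=> oU x Ux; exists U; do 3!split=> //; exists d, (fun=> 0), 0, 1%:MP.
split; first exact: multihom0.
split; first exact: multihomC.
split=> [i|y alpha _ _]; first by rewrite subr0.
by rewrite /peval mevalC rmorph0 mul0r oner_neq0.
Qed.

Lemma line_section_sum d U (n : nat) (s : 'I_n -> 'M[K]_(m, 2) -> K) :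
  zariski_open U -> (forall i, line_section d U (s i)) ->
  line_section d U (fun alpha => \sum_i s i alpha).
Proof.
move=> oU; elim: n s => [|n IH] s hs.
  by under [fun alpha => _]funext => alpha do rewrite big_ord0; apply: line_section0.
under [fun alpha => _]funext => alpha do rewrite big_ord_recl.
by apply: line_sectionD => //; apply: IH.
Qed.

End Sections.

(** * From fibres to sheaves *)

Section Fibres.
Variables (K : closedFieldType) (m : nat).
Implicit Types (alpha : 'M[K]_(m, 2)).

Lemma mxeval_mul alpha (p q r : nat) (M : 'M[cox_ring K m]_(p, q))
    (N : 'M[cox_ring K m]_(q, r)) :
  mxeval alpha (M *m N) = mxeval alpha M *m mxeval alpha N.
Proof. exact: map_mxM. Qed.

Lemma mxeval_const alpha (p q : nat) (C : 'M[K]_(p, q)) :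
  mxeval alpha (map_mx (@mpolyC (m * 2) K) C) = C.
Proof. by apply/matrixP => i j; rewrite !mxE /peval mevalC. Qed.

Lemma fibre_injective_sheaf (p q : nat) (D : 'I_q -> 'I_m -> int)
    (M : 'M[cox_ring K m]_(p, q)) :
  fibre_injective M -> sheaf_injective D M.
Proof.
move=> Minj U s _ _ Ms0 x alpha Ux ha; apply: (Minj x _ ha).
by rewrite mulmx0; apply: Ms0 Ux ha.
Qed.

(* At a point x, let C be a constant right inverse of M(x). Near x the square
   matrix M C stays invertible, so C adj(M C) / det(M C) is a right inverse of
   M with regular entries. *)
Lemma fibre_surjective_sheaf (p q : nat) (M : 'M[cox_ring K m]_(p, q)) :
  (forall i j, multihom (fun=> 1) (M i j)) -> fibre_surjective M ->
  sheaf_surjective (Osum m q 0) (Osum m p 1) M.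
Proof.
move=> hM Msurj U t oU ht x Ux.
have [alpha0 ha0] := hcoords_ex x.
(* Preimages of the standard basis vectors under [M(alpha0)] become the columns of [C]. *)
have /fin_all_exists[v hv] : forall j : 'I_p, exists v : 'cV[K]_q,
    mxeval alpha0 M *m v = delta_mx j 0.
  by move=> j; apply: Msurj ha0 _.
pose C := \matrix_(i, j) v j i 0.
have C1 : mxeval alpha0 M *m C = 1%:M.
  apply/matrixP => i j; have /matrixP/(_ i 0) := hv j.
  rewrite !mxE eqxx andbT => <-; apply: eq_bigr => l _; by rewrite !mxE.
pose CX := map_mx (@mpolyC (m * 2) K) C.
pose N := M *m CX.
have hN i j : multihom (fun=> 1) (N i j).
  rewrite mxE; apply: multihom_sum => l _; rewrite mxE mulrC mul_mpolyC.
  exact: multihomZ.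
have hdet := multihom_det hN.
pose V y := U y /\ nonvanishing (\det N) y.
have oV : zariski_open V := zariski_openI oU (zariski_open_nonvanishing hdet).
have detE alpha : peval alpha (\det N) = \det (mxeval alpha N).
  by rewrite /mxeval det_map_mx.
have Vx : V x.
  split=> //; apply: (nonvanishing_at hdet ha0).
  by rewrite detE mxeval_mul mxeval_const C1 det1 oner_neq0.
exists V; do 2!split=> //; split; first by move=> y [].
pose G := CX *m \adj N.
exists (fun alpha => (peval alpha (\det N))^-1 *: (mxeval alpha G *m t alpha)).
split.
  move=> j.
  have hG l : multihom (fun=> p.-1%:Z) (G j l).
    rewrite mxE; apply: multihom_sum => i _; rewrite mxE mul_mpolyC.
    by apply: multihomZ; apply: multihom_adj.
  have tV l : line_section (fun=> 1) V (fun alpha => t alpha l 0).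
    by apply: (line_section_sub oV _ (ht l)) => y [].
  have fV l : line_section (fun=> p.-1%:Z - p%:Z) V
      (fun alpha => peval alpha (G j l) / peval alpha (\det N)).
    by apply: line_section_fraction => // y [].
  have sV := line_section_sum oV (fun l => line_sectionM (fV l) (tV l)).
  have -> : (fun alpha => ((peval alpha (\det N))^-1 *: (mxeval alpha G *m t alpha)) j 0) =
      (fun alpha => \sum_l peval alpha (G j l) / peval alpha (\det N) * t alpha l 0).
    apply/funext => alpha; rewrite !mxE mulr_sumr; apply: eq_bigr => l _.
    by rewrite mxE mulrA (mulrC _^-1).
  (* Each summand has multidegree [p.-1 - p + 1], which is 0 only for [p > 0]; for [p = 0] it is 1,
     but then the sum is empty. *)
  case: (posnP p) => [p0|p_gt0].
    have -> : (fun alpha => \sum_l peval alpha (G j l) / peval alpha (\det N) * t alpha l 0) = fun=> 0.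
      apply/funext => alpha; apply: big1 => l _.
      by have := ltn_ord l; rewrite [X in (_ < X)%N]p0.
    exact: line_section0.
  by refine (line_section_ext sV _) => i; rewrite /Osum; lia.
move=> y alpha [Uy nN] ha; rewrite /on_sections -scalemxAr mulmxA -mxeval_mul.
(* [M *m G] is [N *m \adj N], that is, [\det N] times the identity. *)
rewrite /G mulmxA -/N mul_mx_adj /mxeval /peval map_scalar_mx /= mul_scalar_mx scalerA.
by rewrite mulVf ?scale1r //; apply: nN.
Qed.

End Fibres.

(** * The matrices of the monad *)

(** Comparison of lowest-order terms, as for a product of two power series: if [c j1] is the first
    nonzero coefficient, then coefficient [j1 + i] of the product determines [w i] once the earlier
    [w] vanish. Since [j1 <= n], the coefficients below [n + k] reach every [i < k]. *)
Lemma eq0_of_conv (K : fieldType) (k n j0 : nat) (c : int -> K) (w : 'I_k -> K) :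
  (forall j : int, j < 0 -> c j = 0) -> (j0 <= n)%N -> c j0 != 0 ->
  (forall l, (l < n + k)%N -> \sum_i w i * c (l%:Z - (i : nat)%:Z) = 0) ->
  forall i, w i = 0.
Proof.
move=> cneg j0n cj0 conv.
have exj : exists j : nat, (j <= n)%N && (c j != 0) by exists j0; rewrite j0n.
case: (ex_minnP exj) => j1 /andP[j1n cj1] jmin.
have clt (j : int) : j < j1 -> c j = 0.
  case: j => [j|j _]; last exact: cneg.
  rewrite ltz_nat => jj1; apply/eqP; apply: contraT => cj.
  by have := jmin j; rewrite cj andbT; lia.
(* Strong induction on [i], phrased with a bound [a]. *)
suff w0 a (i : 'I_k) : (i < a)%N -> w i = 0 by move=> i; apply: (w0 i.+1).
elim: a i => // a IH i; rewrite ltnS leq_eqVlt => /orP[/eqP ia|]; last exact: IH.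
have l_lt : (j1 + i < n + k)%N by have := ltn_ord i; lia.
have /eqP := conv _ l_lt.
(* Only the term [i] survives: for [i' < i] the induction hypothesis gives [w i' = 0], and for
   [i' > i] the index of [c] is below [j1]. *)
rewrite (bigD1 i) //= big1 => [|i' i'i]; last first.
  have [lt_i'i|le_ii'] := ltnP i' i; first by rewrite IH ?mul0r // -ia.
  rewrite clt ?mulr0 //; have : (i' != i :> nat) by []; lia.
rewrite addr0 PoszD addrK mulf_eq0 (negbTE cj1) orbF => /eqP; exact.
Qed.

(** The last digit is [f 0] and the others come from the shifted sequence. Here [t] counts from the
    least significant digit. *)
Lemma binary_digits (f : nat -> 'I_2) (p : nat) :
  exists2 j, (j < 2 ^ p)%N & forall t, (t < p)%N -> ((j %/ 2 ^ t) %% 2)%N = f t.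
Proof.
elim: p f => [|p IH] f; first by exists 0%N.
have [j jp hj] := IH (fun t => f t.+1).
have f0 := ltn_ord (f 0%N).
exists (j * 2 + f 0)%N; first by rewrite expnSr; lia.
case=> [_|t tp]; first by rewrite expn0 divn1 modnMDl modn_small.
by rewrite expnS divnMA divnMDl // (divn_small f0) addn0 hj.
Qed.

Section Monad.
Variables (K : closedFieldType) (m : nat).
Hypothesis m_gt0 : (0 < m)%N.
Implicit Types (alpha : 'M[K]_(m, 2)).

Let i0 : 'I_m := Ordinal m_gt0.

Lemma eps_of_surj (eps : 'I_m -> 'I_2) :
  exists2 j, (j <= nn m)%N & forall i, i != i0 -> eps_of 0 j i = eps i.
Proof.
(* The digit of weight [2 ^ t] belongs to factor [m - 1 - t], which is [rev_ord] of [t]; the default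
   [i0] of [insubd] concerns only [t >= m]. *)
have [j jlt hj] := binary_digits (fun t => eps (rev_ord (insubd i0 t))) (m - 1).
exists j => [|i i_neq0]; first by rewrite /nn; lia.
have i_gt0 : (0 < i)%N by rewrite lt0n.
have i_lt := ltn_ord i.
rewrite /eps_of -[(i == 0 :> nat)%N]/(i == i0) (negbTE i_neq0); apply/val_inj.
rewrite /= inordK ?ltn_mod // hj; last by lia.
congr (val (eps _)); apply/val_inj; rewrite /= val_insubd; case: ifP; lia.
Qed.

(* The factor common to x_j and y_j, the part of the monomial that involves
   only the coordinates of the last m - 1 factors of X. *)
Definition tail_mon (j : int) : cox_ring K m :=
  if j is Posz j' then
    if (j' <= nn m)%N then \prod_(i | i != i0) hvar K i (eps_of 0 j' i) else 0
  else 0.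

Lemma xyE (e : 'I_2) (j : int) : xy K m e j = hvar K i0 e * tail_mon j.
Proof.
rewrite /xy /tail_mon; case: j => [j|j]; last by rewrite mulr0.
case: ifP => _; last by rewrite mulr0.
rewrite /a_mon (bigD1 i0) //=; congr (_ * _); apply: eq_bigr => i ii0.
by rewrite /eps_of -[(i == 0 :> nat)%N]/(i == i0) (negbTE ii0).
Qed.

(** Choosing a nonzero coordinate in every factor spells out [j] in binary, and the monomial is then
    a product of nonzero values. *)
Lemma tail_mon_neq0 (x : multiP1 K m) alpha :
  hcoords x alpha -> exists2 j, (j <= nn m)%N & peval alpha (tail_mon j) != 0.
Proof.
move=> ha.
have /fin_all_exists[eps heps] : forall i, exists e, alpha i e != 0.
  by move=> i; have [_ /rV0Pn[e]] := ha i; rewrite mxE => nz; exists e.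
have [j jn hj] := eps_of_surj eps; exists j => //.
rewrite /= jn /peval rmorph_prod /=; apply/prodf_neq0 => i ii0.
by rewrite /hvar mevalXU mxvecE hj.
Qed.

Definition tail_B k : 'M[cox_ring K m]_(k, nn m + k) :=
  \matrix_(i, l) tail_mon ((l : nat)%:Z - (i : nat)%:Z).

Definition tail_A k : 'M[cox_ring K m]_(nn m + k, k) :=
  \matrix_(l, j) tail_mon ((nn m)%:Z - (l : nat)%:Z + (j : nat)%:Z).

Lemma B_blkE k e : B_blk K m k e = hvar K i0 e *: tail_B k.
Proof. by apply/matrixP => i l; rewrite !mxE xyE. Qed.

Lemma A_blkE k e : A_blk K m k e = hvar K i0 e *: tail_A k.
Proof. by apply/matrixP => i l; rewrite !mxE xyE. Qed.

(** The two block products are the same multiple of [tail_B k *m tail_A k], with opposite signs. *)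
Lemma Bbar_mul_Abar k : Bbar K m k *m Abar K m k = 0.
Proof.
rewrite /Bbar /Abar mul_row_col !B_blkE !A_blkE mulmxN.
by rewrite -!scalemxAl -!scalemxAr !scalerA mulrC addrC subrr.
Qed.

Lemma hvar_head_neq0 (x : multiP1 K m) alpha :
  hcoords x alpha -> exists e, peval alpha (hvar K i0 e) != 0.
Proof.
move=> ha; have [_ /rV0Pn[e]] := ha i0; rewrite mxE => nz; exists e.
by rewrite /peval /hvar mevalXU mxvecE.
Qed.

Lemma mxeval_scale alpha (p q : nat) (h : cox_ring K m) (M : 'M[cox_ring K m]_(p, q)) :
  mxeval alpha (h *: M) = peval alpha h *: mxeval alpha M.
Proof. exact: map_mxZ. Qed.

(** * Maximal rank at the points of X *)

Lemma tail_mon_out (j : int) : (j < 0) || ((nn m)%:Z < j) -> tail_mon j = 0.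
Proof. by case: j => [j|j] //= h; case: ifP => //; lia. Qed.

Lemma tail_A_free k (x : multiP1 K m) alpha (v : 'cV[K]_k) :
  hcoords x alpha -> mxeval alpha (tail_A k) *m v = 0 -> v = 0.
Proof.
move=> /tail_mon_neq0[j jn nz] Av0; apply/colP => i; rewrite mxE.
(* The reversed sequence: [c (l - a)] is entry [(l, a)] of [tail_A] at [alpha], so the product with
   [v] is a convolution. A nonzero value at [j] now sits at [nn m - j]. *)
pose c (l : int) := peval alpha (tail_mon ((nn m)%:Z - l)).
apply: (@eq0_of_conv K k (nn m) (nn m - j) c (fun i => v i 0)).
- by move=> l l0; rewrite /c tail_mon_out ?/peval ?rmorph0 //; lia.
- lia.
- by rewrite /c -subzn // opprB addrC subrK.
move=> l llt; have /colP/(_ (Ordinal llt)) := Av0; rewrite !mxE => e0; rewrite -[RHS]e0.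
apply: eq_bigr => a _; rewrite !mxE mulrC /c; congr (peval _ (tail_mon _) * _).
by rewrite opprB addrA addrAC.
Qed.

(** Entry [l] of the product is coefficient [l] of the convolution of [w] with the values of
    [tail_mon]. *)
Lemma tail_B_free k (x : multiP1 K m) alpha (w : 'rV[K]_k) :
  hcoords x alpha -> w *m mxeval alpha (tail_B k) = 0 -> w = 0.
Proof.
move=> /tail_mon_neq0[j jn nz] wB0; apply/rowP => i; rewrite mxE.
apply: (@eq0_of_conv K k (nn m) j (fun l => peval alpha (tail_mon l)) (fun i => w 0 i)) => //.
  by move=> l l0; rewrite tail_mon_out ?l0 // /peval rmorph0.
move=> l llt; have /rowP/(_ (Ordinal llt)) := wB0; rewrite !mxE => e0; rewrite -[RHS]e0.
by apply: eq_bigr => a _; rewrite !mxE.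
Qed.

(** By linearity a trivial kernel suffices. The two blocks are, up to sign, the multiples of
    [tail_A] by the two coordinates of the first factor, and a nonzero one can be cancelled. *)
Lemma fibre_injective_Abar k : fibre_injective (Abar K m k).
Proof.
move=> x alpha ha v w /eqP; rewrite -subr_eq0 -mulmxBr => /eqP Avw.
apply/eqP; rewrite -subr_eq0; apply/eqP; apply: (tail_A_free ha).
have [e nz] := hvar_head_neq0 ha.
suff h f : peval alpha (hvar K i0 f) *: (mxeval alpha (tail_A k) *m (v - w)) = 0.
  by have /eqP := h e; rewrite scaler_eq0 (negbTE nz) => /eqP.
move: Avw; rewrite /Abar /mxeval map_col_mx mul_col_mx -col_mx0 => /eq_col_mx[].
rewrite /peval map_mxN mulNmx => /eqP; rewrite oppr_eq0 => /eqP h1 h0.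
rewrite scalemxAl -mxeval_scale -A_blkE.
(* The value [f = 0] uses the lower block of [Abar], and [f = 1] the upper one. *)
by case: f => -[|[|//]] ? //; [move: h0|move: h1]; congr (map_mx _ (A_blk K m k _) *m _ = 0);
  apply/val_inj.
Qed.

(** Over a field it suffices that the left kernel is trivial: the rows are then independent, and a
    right inverse [C] gives the preimage [C *m w]. *)
Lemma fibre_surjective_Bbar k : fibre_surjective (Bbar K m k).
Proof.
move=> x alpha ha w.
suff /row_freeP[C BC] : row_free (mxeval alpha (Bbar K m k)).
  by exists (C *m w); rewrite mulmxA BC mul1mx.
apply: inj_row_free => v Bv; apply: (tail_B_free ha).
have [e nz] := hvar_head_neq0 ha.
suff h f : peval alpha (hvar K i0 f) *: (v *m mxeval alpha (tail_B k)) = 0.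
  by have /eqP := h e; rewrite scaler_eq0 (negbTE nz) => /eqP.
move: Bv; rewrite /Bbar /mxeval map_row_mx mul_mx_row -row_mx0 => /eq_row_mx[h0 h1].
rewrite scalemxAr -mxeval_scale -B_blkE.
by case: f => -[|[|//]] ? //; [move: h0|move: h1]; congr (_ *m map_mx _ (B_blk K m k _) = 0);
  apply/val_inj.
Qed.

Lemma multihom_Bbar k i j : multihom (fun=> 1) (Bbar K m k i j).
Proof. by rewrite !mxE; case: split => l; rewrite mxE; apply: multihom_xy. Qed.

Lemma multihom_Abar k i j : multihom (fun=> 1) (Abar K m k i j).
Proof.
rewrite !mxE; case: split => l; rewrite !mxE; last exact: multihom_xy.
by apply: multihomN; apply: multihom_xy.
Qed.

End Monad.

Theorem mainTheorem7 (R : realType) (m k : nat) (hm : (2 <= m)%N)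
    (hk : (1 <= k)%N) :
  Bbar R[i] m k *m Abar R[i] m k = 0 /\
  fibre_injective (Abar R[i] m k) /\
  fibre_surjective (Bbar R[i] m k) /\
  is_monad
    (Osum m k (-1))
    (Osum m ((nn m + k) + (nn m + k)) 0)
    (Osum m k 1)
    (Abar R[i] m k) (Bbar R[i] m k).
Proof.
have m_gt0 : (0 < m)%N by apply: leq_trans hm.
have BA := Bbar_mul_Abar R[i] m_gt0 k.
have Ainj := @fibre_injective_Abar R[i] m m_gt0 k.
have Bsurj := @fibre_surjective_Bbar R[i] m m_gt0 k.
do 3!split=> //; split.
(* The required multidegrees [0 - (-1)] and, for [Bbar], [1 - 0] both compute to 1. *)
- by move=> i j; refine (multihom_ext (@multihom_Abar R[i] m k i j) _).
- by move=> i j; refine (multihom_ext (@multihom_Bbar R[i] m k i j) _).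
- move=> U s _ _ x alpha _ _.
  by rewrite /on_sections mulmxA -mxeval_mul BA /mxeval /peval map_mx0 mul0mx.
- exact: fibre_injective_sheaf.
by apply: fibre_surjective_sheaf => // i j; apply: multihom_Bbar.
Qed.
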